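(* Let $m\ge2$ be even and let $G=(V,A)$ be an $m$-uniform directed circulant hypergraph with $V=[n]$, $n\ge2$. Then the Laplacian tensor $\mathcal{L}(G)$ and the signless Laplacian tensor $\mathcal{Q}(G)$ of $G$ are positive semi-definite.
   Context: Write $[n]=\{1,\dots,n\}$. An $m$-uniform directed hypergraph $G=(V,A)$ has vertex set $V=[n]$ and a set $A$ of arcs; each arc has the form $e=(j_1,\dots,j_m)$ with $j_1,\dots,j_m\in V$ pairwise distinct, where $j_1$ is the tail of $e$ and $j_2,\dots,j_m$ are the heads; the order of the heads $j_2,\dots,j_m$ is irrelevant (so an arc is a tail together with an unordered set of $m-1$ heads). The degree of a vertex $j$ is $d(j)=|\{e\in A: j\text{ is the tail of }e\}|$. $G$ is a directed circulant hypergraph if whenever $(j_1,\dots,j_m)\in A$ and $k_l\in[n]$, $k_l\equiv j_l+1\pmod n$ for $l\in[m]$, also $(k_1,\dots,k_m)\in A$. The adjacency tensor $\mathcal{A}(G)=(a_{j_1\cdots j_m})$ is the $m$th order $n$-dimensional tensor with $a_{j_1\cdots j_m}=\frac1{(m-1)!}$ if $(j_1,\dots,j_m)\in A$ and $0$ otherwise. The degree tensor $\mathcal{D}(G)$ is the $m$th order $n$-dimensional diagonal tensor whose $j$th diagonal entry is $d(j)$. Define $\mathcal{L}(G)=\mathcal{D}(G)-\mathcal{A}(G)$ and $\mathcal{Q}(G)=\mathcal{D}(G)+\mathcal{A}(G)$. For even $m$, a real $m$th order $n$-dimensional tensor $\mathcal{T}=(t_{j_1\cdots j_m})$ (not necessarily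 symmetric) is positive semi-definite if $\sum_{j_1,\dots,j_m=1}^n t_{j_1\cdots j_m}x_{j_1}\cdots x_{j_m}\ge0$ for all $\mathbf{x}\in\mathbb{R}^n$. *)

(* Defs.v *)
From HB Require Import structures.
From mathcomp Require Import all_boot all_order all_algebra.
From mathcomp Require Import reals.
Set Implicit Arguments.
Unset Strict Implicit.
Unset Printing Implicit Defensive.
Import Order.TTheory GRing.Theory Num.Theory.
Local Open Scope ring_scope.

(* The vertex set [n] is rendered by 'I_n, i.e. vertex j of [n] is the ordinal
   j - 1. *)

(* An arc is a pair (tail, set of heads), so the order of the heads is
   irrelevant by construction and #|arcs| counts arcs up to that order. *)
Record dihypergraph (m n : nat) := Dihypergraph {
  arcs : {set 'I_n * {set 'I_n}};
  arcs_uniform : forall e, e \in arcs -> e.1 \notin e.2 /\ #|e.2| = m.-1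
}.

(* (j_1, ..., j_m) \in A for an ordered tuple of vertices. *)
Definition tuple_arc (m n : nat) (G : dihypergraph m n)
    (t : m.-tuple 'I_n) : bool :=
  if tval t is j :: hs then uniq t && ((j, [set x in hs]) \in arcs G)
  else false.

Definition degree (m n : nat) (G : dihypergraph m n) (j : 'I_n) : nat :=
  #|[set e in arcs G | e.1 == j]|.

Definition circulant (m n : nat) (G : dihypergraph m n) : Prop :=
  forall t u : m.-tuple 'I_n,
    tuple_arc G t ->
    (forall l : 'I_m, tnth u l = tnth t l + 1 %[mod n])%N ->
    tuple_arc G u.

(* Tensors of order m and dimension n, with the pointwise zmodType structure
   of finite functions. *)
Notation tensor R m n := {ffun m.-tuple 'I_n -> R}.

Definition adjacency_tensor (R : realType) (m n : nat)
    (G : dihypergraph m n) : tensor R m n :=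
  [ffun t => if tuple_arc G t then ((m.-1)`!%:R)^-1 else 0].

(* [constant t] says that all the indices in t coincide. *)
Definition diag_tensor (R : realType) (m n : nat)
    (d : 'I_n -> R) : tensor R m n :=
  [ffun t : m.-tuple 'I_n =>
    (if tval t is j :: _ then (if constant t then d j else 0) else 0) : R].

Definition degree_tensor (R : realType) (m n : nat)
    (G : dihypergraph m n) : tensor R m n :=
  diag_tensor m (fun j => (degree G j)%:R).

Definition laplacian_tensor (R : realType) (m n : nat)
    (G : dihypergraph m n) : tensor R m n :=
  degree_tensor R G - adjacency_tensor R G.

Definition signless_laplacian_tensor (R : realType) (m n : nat)
    (G : dihypergraph m n) : tensor R m n :=
  degree_tensor R G + adjacency_tensor R G.

Definition tensor_form (R : realType) (m n : nat) (T : tensor R m n)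
    (x : 'rV[R]_n) : R :=
  \sum_(t : m.-tuple 'I_n) T t * \prod_(l < m) x 0 (tnth t l).

(* Only meaningful for even m; T is not assumed symmetric. *)
Definition psd_tensor (R : realType) (m n : nat) (T : tensor R m n) : Prop :=
  forall x : 'rV[R]_n, 0 <= tensor_form T x.

(* Main.v *)
Require Import Defs.
From HB Require Import structures.
From mathcomp Require Import all_boot all_order all_algebra.
From mathcomp Require Import reals.
Import Order.TTheory GRing.Theory Num.Theory.

(** By AM-GM and the evenness of [m], the monomial of an ordered arc is at most
    the mean of [x_j ^+ m] over its [m] positions. Invariance under the cyclic
    shift makes the number of ordered arcs with vertex [j] at position [l]
    independent of [j], hence of [l] as well (it is the number of ordered arcs
    divided by [n]); at the tail position it is [(m - 1)! * d(j)]. Summing over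
    ordered arcs, the form of the adjacency tensor is dominated in absolute
    value by that of the degree tensor. *)

Section CirculantForms.
Set Implicit Arguments.
Unset Strict Implicit.
Local Open Scope ring_scope.

Lemma tensor_formD (R : realType) m n (S T : tensor R m n) x :
  tensor_form (S + T) x = tensor_form S x + tensor_form T x.
Proof.
by rewrite -big_split; apply: eq_bigr => t _; rewrite /= ffunE mulrDl.
Qed.

Lemma tensor_formN (R : realType) m n (T : tensor R m n) x :
  tensor_form (- T) x = - tensor_form T x.
Proof.
by rewrite -sumrN; apply: eq_bigr => t _; rewrite /= ffunE mulNr.
Qed.

Lemma diag_tensor_form (R : realType) k n (d : 'I_n -> R) (x : 'rV[R]_n) :
  tensor_form (diag_tensor k.+1 d) x = \sum_j d j * x 0 j ^+ k.+1.
Proof.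
pose cst (j : 'I_n) := [tuple of nseq k.+1 j].
rewrite /tensor_form (bigID (fun t : k.+1.-tuple 'I_n => constant t)) /=.
rewrite [X in _ + X]big1 ?addr0; last first.
  by move=> t /negPf ct; rewrite ffunE; case: (tval t) ct => [|j s] /= => [|->]; rewrite ?mul0r.
(* Constant tuples correspond to vertices: [cst] has inverse [thead] on them. *)
rewrite (reindex_onto cst (fun t => thead t)) /=; last first.
  move=> t; case/tupleP: t => j s /= /all_pred1P ss.
  by apply: val_inj; rewrite /= theadE ss size_tuple.
apply: eq_big => [j|j _].
  by rewrite /thead tnth_nseq eqxx all_pred1_nseq.
rewrite ffunE /= all_pred1_nseq; congr (_ * _).
under eq_bigr => l _ do rewrite tnth_nseq.
by rewrite prodr_const card_ord.
Qed.

Lemma normr_prod_le_mean (R : realType) m (E : 'I_m -> R) :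
  (0 < m)%N -> ~~ odd m ->
  `|\prod_l E l| <= (\sum_l E l ^+ m) / m%:R.
Proof.
move=> m_gt0 m_even.
have Em_ge0 l : 0 <= E l ^+ m by exact: exprn_even_ge0.
(* Both sides are nonnegative, so their [m]-th powers may be compared; since [m] is even, the left
   one is the product of the [E l ^+ m], ready for AM-GM. *)
rewrite -(@ler_pXn2r _ m) ?nnegrE // ?divr_ge0 ?sumr_ge0 ?ler0n //.
rewrite -normrX -prodrXl ger0_norm ?prodr_ge0 //.
have := @leif_AGM _ _ [pred l : 'I_m | true] (fun l => E l ^+ m) (fun l _ => Em_ge0 l).
by rewrite card_ord => -[].
Qed.

(** A duplicate-free [k]-tuple with entries in [B] already exhausts [B], so the falling factorial
    [k ^_ k] counts these tuples. *)
Lemma card_tuples_spanning (T : finType) k (B : {set T}) :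
  #|B| = k ->
  #|[set s : k.-tuple T | uniq s & [set y in s] == B]| = (k`!)%N.
Proof.
move=> cB.
rewrite -(ffactnn k) -[in X in (X ^_ _)%N]cB -card_uniq_tuples.
apply: eq_card => s; rewrite !inE andbC; apply: andb_id2r => us.
have cs : #|[set y in s]| = k by rewrite cardsE (card_uniqP us) size_tuple.
rewrite eqEcard cs cB leqnn andbT.
apply/subsetP/allP => sB y; first by move=> ys; apply: sB; rewrite inE.
by rewrite inE; apply: sB.
Qed.

Definition tuple_arcs_at m n (G : dihypergraph m n) (l : 'I_m) (j : 'I_n) :=
  [set t : m.-tuple 'I_n | tuple_arc G t & tnth t l == j].

(** Dropping the tail leaves an ordering of the heads; grouping by underlying arc, each arc with
    tail [j] arises from [k]! orderings. *)
Lemma card_tuple_arcs_at_tail k n (G : dihypergraph k.+1 n) j :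
  #|tuple_arcs_at G ord0 j| = (degree G j * k`!)%N.
Proof.
pose H := [set s : k.-tuple 'I_n | uniq s & (j, [set y in s]) \in arcs G].
have -> : tuple_arcs_at G ord0 j = [set cons_tuple j s | s in H].
  apply/setP => t; apply/idP/imsetP => [|[s]].
    case/tupleP: t => i s; rewrite inE /tuple_arc /= tnth0.
    case/andP=> /andP[/andP[_ us] Gs] /eqP ij; subst i.
    by exists s; rewrite // inE us.
  rewrite inE => /andP[us Gs] ->; rewrite inE /tuple_arc /= tnth0 eqxx us Gs.
  by have [/= + _] := arcs_uniform Gs; rewrite inE => ->.
rewrite card_imset; last first.
  by move=> s u /(congr1 val) /= [su]; apply: val_inj.
rewrite -sum1_card (partition_big (fun s : k.-tuple 'I_n => (j, [set y in s]))
  (fun e => e \in [set e in arcs G | e.1 == j])) /=; last first.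
  by move=> s; rewrite !inE eqxx andbT => /andP[].
rewrite /degree -sum_nat_const; apply: eq_bigr => -[i B].
rewrite inE /= => /andP[Ge /eqP ij]; subst i.
have [_ /= cB] := arcs_uniform Ge.
rewrite sum1dep_card -(card_tuples_spanning cB).
apply: eq_card => s; rewrite !inE xpair_eqE eqxx /= -andbA.
by apply: andb_id2l => _; case: eqP => [->|]; rewrite ?Ge ?andbF.
Qed.

Lemma val_iter_ordS n k (j : 'I_n) : iter k (@ordS n) j = ((j + k) %% n)%N :> nat.
Proof.
elim: k => [|k IHk]; first by rewrite addn0 modn_small.
by rewrite iterS /= IHk -addn1 modnDml addn1 addnS.
Qed.

(** The cyclic shift maps the first set injectively into the second. *)
Lemma card_tuple_arcs_at_ordS m n (G : dihypergraph m n) l j : circulant G ->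
  (#|tuple_arcs_at G l j| <= #|tuple_arcs_at G l (ordS j)|)%N.
Proof.
move=> circG; pose shift (t : m.-tuple 'I_n) := map_tuple (@ordS n) t.
have shift_inj : injective shift.
  move=> t u /(congr1 val) /= /(inj_map (@ordS_inj n)); exact: val_inj.
rewrite -(card_imset _ shift_inj); apply/subset_leq_card/subsetP => _ /imsetP[t + ->].
rewrite inE => /andP[Gt /eqP tl]; rewrite inE tnth_map tl eqxx andbT.
by apply: circG Gt _ => i; rewrite tnth_map /= modn_mod addn1.
Qed.

Lemma card_tuple_arcs_at_const m n (G : dihypergraph m n) l i j : circulant G ->
  #|tuple_arcs_at G l i| = #|tuple_arcs_at G l j|.
Proof.
move=> circG; suff le_card i' j' :
    (#|tuple_arcs_at G l i'| <= #|tuple_arcs_at G l j'|)%N.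
  by apply/eqP; rewrite eqn_leq !le_card.
(* Going round the cycle reaches every vertex, so the one-step inequality holds between any two;
   adding [n] keeps the subtraction from truncating. *)
have -> : j' = iter (j' + n - i')%N (@ordS n) i'.
  apply: val_inj; rewrite /= val_iter_ordS subnKC ?modnDr ?modn_small //.
  by rewrite (leq_trans (ltnW (ltn_ord i'))) ?leq_addl.
elim: (_ - _)%N => //= k; move/leq_trans; apply; exact: card_tuple_arcs_at_ordS.
Qed.

(** The values lie in a general [nmodType] to serve both for counting in [nat] and for summing
    powers in [R]. *)
Lemma sum_tuple_arcs_at (V : nmodType) m n (G : dihypergraph m n) l
    (f : 'I_n -> V) :
  \sum_(t | tuple_arc G t) f (tnth t l) =
  \sum_j f j *+ #|tuple_arcs_at G l j|.
Proof.
rewrite (partition_big (fun t : m.-tuple 'I_n => tnth t l) predT) //=.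
apply: eq_bigr => j _; rewrite -sumr_const.
by apply: eq_big => [t|t /andP[_ /eqP ->]]; rewrite ?inE.
Qed.

Lemma card_tuple_arcs_at_position m n (G : dihypergraph m n) l l' j :
  circulant G -> #|tuple_arcs_at G l j| = #|tuple_arcs_at G l' j|.
Proof.
move=> circG; have n_gt0 : (0 < n)%N by apply: leq_trans (ltn_ord j).
(* The right-hand side does not mention the position [i]. *)
have card_mul i : (n * #|tuple_arcs_at G i j|)%N = #|[set t | tuple_arc G t]|.
  rewrite -sum1dep_card (sum_tuple_arcs_at G i (fun=> 1%N)).
  rewrite -{1}(card_ord n) -sum_nat_const; apply: eq_bigr => j' _.
  by rewrite (card_tuple_arcs_at_const i j' j circG) [RHS]natn.
by apply/eqP; rewrite -(eqn_pmul2l n_gt0) !card_mul.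
Qed.

Lemma adjacency_form_le_degree_form (R : realType) m n (G : dihypergraph m n)
    (x : 'rV[R]_n) : (0 < m)%N -> ~~ odd m -> circulant G ->
  `|tensor_form (adjacency_tensor R G) x| <= tensor_form (degree_tensor R G) x.
Proof.
case: m G => // k G _ m_even circG.
have formA : tensor_form (adjacency_tensor R G) x =
    (\sum_(t | tuple_arc G t) \prod_l x 0 (tnth t l)) / (k`!)%:R.
  rewrite mulr_suml [RHS]big_mkcond; apply: eq_bigr => t _; rewrite ffunE.
  by case: ifP; rewrite ?mul0r // mulrC.
rewrite formA diag_tensor_form normrM normfV normr_nat.
rewrite ler_pdivrMr ?ltr0n ?fact_gt0 //.
apply: (le_trans (ler_norm_sum _ _ _)).
apply: (@le_trans _ _ (\sum_(t | tuple_arc G t)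
    (\sum_l x 0 (tnth t l) ^+ k.+1) / k.+1%:R)).
  by apply: ler_sum => t _; apply: normr_prod_le_mean.
rewrite -mulr_suml exchange_big /= ler_pdivrMr ?ltr0n //.
(* Each position contributes [k]! times the degree form, as the tail does; the [k.+1] equal terms
   cancel the denominator of the mean. *)
under eq_bigr => l _.
  rewrite (sum_tuple_arcs_at G l (fun j => x 0 j ^+ k.+1)).
  under eq_bigr => j _ do
    rewrite (card_tuple_arcs_at_position l ord0 j circG)
      card_tuple_arcs_at_tail -mulr_natl natrM mulrAC.
  rewrite -mulr_suml; over.
by rewrite sumr_const card_ord -[leLHS]mulr_natr.
Qed.

End CirculantForms.

Theorem corollary3 (R : realType) (m n : nat) (hm : 2 <= m)
  (hm_even : ~~ odd m) (hn : 2 <= n) (G : dihypergraph m n)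
  (hG : circulant G) :
  psd_tensor (laplacian_tensor R G) /\
  psd_tensor (signless_laplacian_tensor R G).
Proof.
have le_form (x : 'rV[R]_n) :=
  @adjacency_form_le_degree_form R m n G x (ltnW hm) hm_even hG.
(* The bound on the absolute value covers both signs of the adjacency form. *)
split=> x; rewrite tensor_formD ?tensor_formN.
  by rewrite subr_ge0 (le_trans (ler_norm _)).
by rewrite -lerBlDr sub0r (le_trans _ (le_form x)) // -normrN ler_norm.
Qed.
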